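(* Let $M\geq7$ and $N=\binom{M+1}{2}$. Let $\Psi$ be an $M\times(M+1)$ regular simplex, and let $g\in\mathbb{R}^{M+1}$ be $$g=(a,a,\underbrace{b,b,\ldots,b}_{M-1\text{ times}}),\qquad a=\sqrt{\frac{M-1}{2(M+1)}},\qquad b=-\sqrt{\frac{2}{(M+1)(M-1)}}.$$ Let $F$ be the $M\times\binom{M+1}{2}$ frame with columns $\sqrt{M/(M+1)}\,\Psi Pg$, where $Pg$ ranges over the $\binom{M+1}{2}$ distinct permutations of $g$ ($P$ an $(M+1)\times(M+1)$ permutation matrix). Then for every $C\ge1$ and every $p\in[0,1]$ with $(1-p)N$ an integer and $$p\leq\frac{(C^2-1)^2}{(C^2+1)^2(M+1)},$$ $F$ is a $(p,C)$-numerically erasure-robust frame.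
   Context: An $M\times(M+1)$ regular simplex is an $M\times(M+1)$ matrix $\Psi$ (over $\mathbb{C}$) with $\Psi^*\Psi=\frac{M+1}{M}\mathrm{I}_{M+1}-\frac{1}{M}\mathrm{J}_{M+1}$, where $\mathrm{J}_{M+1}$ is the $(M+1)\times(M+1)$ all-ones matrix. An $M\times N$ frame is an $M\times N$ matrix whose columns span $\mathbb{C}^M$. For an $M\times K$ matrix $A$, $\mathrm{Cond}(A)$ is the ratio of its greatest singular value to its smallest one, i.e. $\mathrm{Cond}(A)=\sqrt{\lambda_{\max}(AA^* )/\lambda_{\min}(AA^* )}$ where $AA^*$ is $M\times M$, with $\mathrm{Cond}(A)=\infty$ if $A$ has rank less than $M$. For $\mathcal{K}\subseteq\{1,\dots,N\}$, $F_{\mathcal{K}}$ is the submatrix of $F$ formed by the columns indexed by $\mathcal{K}$. Given $p\in[0,1]$ (with $(1-p)N$ an integer) and $C\ge1$, an $M\times N$ frame $F$ is a $(p,C)$-numerically erasure-robust frame if $\mathrm{Cond}(F_{\mathcal{K}})\le C$ for every $\mathcal{K}\subseteq\{1,\dots,N\}$ of size $(1-p)N$. *)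

(* Defs.v *)
From HB Require Import structures.
From mathcomp Require Import all_boot all_order all_algebra all_fingroup.
From mathcomp Require Import spectral.
From mathcomp Require Import complex.
From mathcomp Require Import all_classical all_reals.

Set Implicit Arguments.
Unset Strict Implicit.
Unset Printing Implicit Defensive.

Import Order.TTheory GRing.Theory Num.Theory.
Local Open Scope classical_set_scope.
Local Open Scope sesquilinear_scope.
Local Open Scope complex_scope.
Local Open Scope ring_scope.

Definition regular_simplex (R : realType) (M : nat)
    (Psi : 'M[R[i]]_(M, M.+1)) : Prop :=
  Psi ^t* *m Psi = (M.+1%:R / M%:R)%:M - M%:R^-1 *: const_mx 1.

(* [row_full F^T] says that the rows of [F^T], i.e. the columns of [F], span
   the whole space. *)
Definition is_frame (R : realType) (M N : nat) (F : 'M[R[i]]_(M, N)) : bool :=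
  row_full F^T.

(* Only real eigenvalues are collected; for a Hermitian matrix these are all
   of them. *)
Definition real_spectrum (R : realType) (n : nat) (A : 'M[R[i]]_n) : set R :=
  [set x : R | eigenvalue A x%:C].

(* The spectrum of the Hermitian matrix [A *m A ^t*] is finite, and nonempty
   for M > 0, so [sup] and [inf] are its maximum and minimum. *)
Definition Cond (R : realType) (M K : nat) (A : 'M[R[i]]_(M, K)) : \bar R :=
  if (\rank A < M)%N then +oo%E
  else (Num.sqrt (sup (real_spectrum (A *m A ^t*)) /
                  inf (real_spectrum (A *m A ^t*))))%:E.

Definition col_submx (R : realType) (M N : nat) (F : 'M[R[i]]_(M, N))
    (K : {set 'I_N}) : 'M[R[i]]_(M, #|K|) :=
  colsub (fun k : 'I_#|K| => enum_val k) F.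

Definition nerf (R : realType) (M N : nat) (p C : R)
    (F : 'M[R[i]]_(M, N)) : Prop :=
  is_frame F /\
  forall K : {set 'I_N}, #|K|%:R = (1 - p) * N%:R ->
    (Cond (col_submx F K) <= C%:E)%E.

Definition gvec (R : realType) (M : nat) : 'cV[R]_M.+1 :=
  \col_(i < M.+1)
    if (i < 2)%N then Num.sqrt ((M%:R - 1) / (2 * (M%:R + 1)))
    else - Num.sqrt (2 / ((M%:R + 1) * (M%:R - 1))).

(* The columns of [F] are the vectors [sqrt (M / (M+1)) Psi v], one for each
   distinct permutation [v] of [g]; [v_] is an arbitrary enumeration, without
   repetition, of these permutations, so no column order is imposed. *)
Definition permutation_columns (R : realType) (M N : nat)
    (Psi : 'M[R[i]]_(M, M.+1)) (g : 'cV[R]_M.+1)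
    (F : 'M[R[i]]_(M, N)) : Prop :=
  exists v_ : 'I_N -> 'cV[R]_M.+1,
    [/\ injective v_,
        range v_ = [set perm_mx s *m g | s in [set: 'S_M.+1]] &
        forall j, col j F =
          (Num.sqrt (M%:R / (M%:R + 1) : R))%:C *:
            (Psi *m map_mx (fun x : R => x%:C) (v_ j))].

(* Main.v *)
Require Import Defs.
From HB Require Import structures.
From mathcomp Require Import all_boot all_order all_algebra all_fingroup.
From mathcomp Require Import spectral complex.
From mathcomp Require Import all_classical all_reals.
From mathcomp Require Import sesquilinear ring lra.

Set Implicit Arguments.
Unset Strict Implicit.
Unset Printing Implicit Defensive.

Import Order.TTheory GRing.Theory Num.Theory.
Local Open Scope ring_scope.
Local Open Scope sesquilinear_scope.

(** The columns of [F] form a unit norm tight frame: they are [N] unit vectors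
with [F F* = (N/M) I].  Any such frame is robust to erasures.  Indeed, deleting
[e = pN] columns subtracts from [F F*] the positive operator [sum f f*] over the
deleted columns, whose norm is at most [e] by Cauchy-Schwarz.  Hence the
spectrum of [F_K F_K*] lies in [[N/M - e, N/M]], and
[Cond(F_K)^2 <= (N/M) / (N/M - e) = 1 / (1 - pM)] ([unit_tight_frame_nerf]).
With [d = (C^2 - 1) / (C^2 + 1)] the bound on [p] gives [pM <= d^2], while
[1 - 1/C^2 = 2d / (1 + d) >= d^2] because [0 <= d <= 1]; so [Cond(F_K) <= C].

That [F] is a unit norm tight frame follows by symmetry from [sum g = 0] and
[|g| = 1] ([gvec_sum0], [gvec_sqnorm]). The matrix [sum v v^T], over the
distinct permutations [v] of [g], is invariant under simultaneous permutation of
rows and columns, has zero row sums and trace [N]; double transitivity of the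
symmetric group makes it [N/(M+1)] times the Gram matrix [Psi* Psi] of the
simplex ([orbit_gramE]). Since moreover [Psi Psi* = ((M+1)/M) I]
([simplex_cogram]), we get [F F* = (M/(M+1)) Psi (sum v v^T) Psi* = (N/M) I].
Finally [Psi* Psi] acts as [(M+1)/M] on vectors of zero sum, so the columns of
[F] have norm [|g| = 1]. *)

(** * Real scalars in the complex field *)

Section RealScalars.
Variable R : realType.

Lemma conjC_real_complex (a : R) : Num.conj (a%:C)%C = (a%:C)%C.
Proof. exact: conjc_real. Qed.

Lemma real_complex_ratio (m n : nat) :
  ((m%:R / n%:R : R)%:C)%C = m%:R / n%:R :> R[i].
Proof. by rewrite (fmorph_div (real_complex R)) !rmorph_nat. Qed.

Lemma conj_scale_real m n (a : R) (A : 'M[R[i]]_(m, n)) :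
  ((a%:C)%C *: A) ^t* = (a%:C)%C *: A ^t*.
Proof.
by apply/matrixP => i j; rewrite !mxE rmorphM /= conjC_real_complex.
Qed.

Lemma conj_map_real m n (A : 'M[R]_(m, n)) :
  (map_mx (real_complex R) A) ^t* = map_mx (real_complex R) A^T.
Proof. by apply/matrixP => i j; rewrite !mxE /= conjC_real_complex. Qed.

End RealScalars.

(** * Erasures from a unit norm tight frame *)

Section TightFrames.
Variable R : realType.
Implicit Types M N K : nat.

Lemma dnormE_sum n (u : 'rV[R[i]]_n) : dotmx u u = \sum_k `|u 0 k| ^+ 2.
Proof. by rewrite dotmxE mxE; apply: eq_bigr => k _; rewrite !mxE -normCK. Qed.

Lemma dnorm_mulmx M K (A : 'M[R[i]]_(M, K)) (v : 'rV_M) :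
  dotmx (v *m A) (v *m A) = dotmx (v *m (A *m A ^t*)) v.
Proof. by rewrite !dotmxE trmx_mul map_mxM !mulmxA. Qed.

Lemma mulmx_coef_dot M K (A : 'M[R[i]]_(M, K)) (v : 'rV_M) k :
  (v *m A) 0 k = dotmx v ((col k A) ^t*).
Proof.
by rewrite dotmxE trmxCK !mxE; apply: eq_bigr => l _; rewrite !mxE.
Qed.

Lemma dnorm_col M K (A : 'M[R[i]]_(M, K)) k :
  dotmx ((col k A) ^t*) ((col k A) ^t*) = (A ^t* *m A) k k.
Proof.
by rewrite dotmxE trmxCK !mxE; apply: eq_bigr => l _; rewrite !mxE.
Qed.

Lemma dnorm_col_submx M N (F : 'M[R[i]]_(M, N)) (K : {set 'I_N}) v :
  dotmx (v *m col_submx F K) (v *m col_submx F K) =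
  \sum_(k in K) `|(v *m F) 0 k| ^+ 2.
Proof.
rewrite dnormE_sum (big_enum_val (fun k => `|(v *m F) 0 k| ^+ 2)) /=.
by apply: eq_bigr => k _; rewrite mulmx_colsub mxE.
Qed.

Section Erasure.
Variables (M N : nat) (F : 'M[R[i]]_(M, N)) (a : R).
Hypothesis tightF : F *m F ^t* = (a%:C)%C%:M.
Hypothesis unitF : forall j, (F ^t* *m F) j j = 1.

Lemma sum_all_coef v : \sum_k `|(v *m F) 0 k| ^+ 2 = (a%:C)%C * dotmx v v.
Proof. by rewrite -dnormE_sum dnorm_mulmx tightF mul_mx_scalar linearZl_LR. Qed.

(** The lower frame bound after erasure: each erased unit vector removes at most
[|v|^2] from the total energy [a |v|^2], by Cauchy-Schwarz. *)
Lemma dnorm_col_submx_ge (K : {set 'I_N}) v :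
  ((a - #|~: K|%:R)%:C)%C * dotmx v v <=
  dotmx (v *m col_submx F K) (v *m col_submx F K).
Proof.
rewrite dnorm_col_submx.
have le_erased : \sum_(k in ~: K) `|(v *m F) 0 k| ^+ 2 <=
    (#|~: K|%:R%:C)%C * dotmx v v.
  rewrite rmorph_nat mulr_natl -sumr_const.
  apply: ler_sum => k _; rewrite mulmx_coef_dot.
  have := CauchySchwarz (@dotmx _ _) v ((col k F) ^t*).
  by rewrite /= dnorm_col unitF mulr1 => ->.
have := sum_all_coef v; rewrite (bigID (mem K)) /=.
rewrite [X in _ + X](eq_bigl (fun k => k \in ~: K)); last first.
  by move=> k; rewrite !inE.
move=> /(canRL (addrK _)) ->.
by rewrite rmorphB mulrBl lerD2l lerN2.
Qed.

Lemma dnorm_col_submx_le (K : {set 'I_N}) v :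
  dotmx (v *m col_submx F K) (v *m col_submx F K) <= (a%:C)%C * dotmx v v.
Proof.
rewrite dnorm_col_submx -sum_all_coef [leRHS](bigID (mem K)) /= lerDl.
by apply: sumr_ge0 => k _; rewrite exprn_ge0.
Qed.

Lemma real_spectrum_col_submx (K : {set 'I_N}) x :
  real_spectrum (col_submx F K *m col_submx F K ^t*) x ->
  a - #|~: K|%:R <= x <= a.
Proof.
move=> /eigenvalueP[v vA v0].
have := dnorm_col_submx_ge K v; have := dnorm_col_submx_le K v.
rewrite dnorm_mulmx vA linearZl_LR /=.
by rewrite !ler_pM2r ?dnorm_gt0 // !lecR => -> ->.
Qed.

(** A vector orthogonal to all the remaining columns would violate the lower
frame bound, which is positive here. *)
Lemma rank_col_submx (K : {set 'I_N}) :
  #|~: K|%:R < a -> \rank (col_submx F K) = M.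
Proof.
move=> ltKa; apply/eqP; rewrite -/(row_free _) -kermx_eq0; apply/rowV0P => v.
move=> /sub_kermxP vF0; apply/eqP/contraT => v0.
have := dnorm_col_submx_ge K v; rewrite vF0 linear0r.
rewrite pmulr_lle0 ?dnorm_gt0 //.
by rewrite lecR subr_le0 leNgt ltKa.
Qed.

Lemma Cond_col_submx_le (K : {set 'I_N}) :
  #|~: K|%:R < a ->
  (Cond (col_submx F K) <= (Num.sqrt (a / (a - #|~: K|%:R)))%:E)%E.
Proof.
move=> ltKa; have gap_gt0 : 0 < a - #|~: K|%:R by rewrite subr_gt0.
rewrite /Cond rank_col_submx // ltnn lee_fin.
(* On an empty [S], [sup] and [inf] are 0, and [0 / 0 = 0] meets the bound, so
   no eigenvalue has to be exhibited. *)
set S := real_spectrum _; have [->|S0] := eqVneq S set0.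
  by rewrite sup0 inf0 mul0r sqrtr0 sqrtr_ge0.
have {}S0 : (S !=set0)%classic by apply/set0P.
have Sbd x (Sx : S x) := andP (real_spectrum_col_submx Sx).
have infS : a - #|~: K|%:R <= inf S by apply: lb_le_inf => // x /Sbd[].
have supS : sup S <= a by apply: ge_sup => // x /Sbd[].
have a_ge0 : 0 <= a by rewrite (le_trans _ (ltW ltKa)).
have inf_gt0 := lt_le_trans gap_gt0 infS.
apply: ler_wsqrtr; apply: (@le_trans _ _ (a / inf S)).
  by rewrite ler_pM2r ?invr_gt0.
by apply: ler_wpM2l => //; rewrite lef_pV2.
Qed.

End Erasure.

(** The hypothesis on [p] says [1 / (1 - pM) <= C^2], where the left side is the
ratio of the two frame bounds that survive the erasure of [pN] columns. *)
Theorem unit_tight_frame_nerf M N (F : 'M[R[i]]_(M, N)) (p C : R) :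
  (0 < M)%N -> (0 < N)%N ->
  F *m F ^t* = ((N%:R / M%:R)%:C)%C%:M ->
  (forall j, (F ^t* *m F) j j = 1) ->
  1 <= C -> p * M%:R <= 1 - (C ^+ 2)^-1 -> nerf p C F.
Proof.
move=> M0 N0 tightF unitF C1 hp.
have M0R : 0 < M%:R :> R by rewrite ltr0n.
have N0R : 0 < N%:R :> R by rewrite ltr0n.
have C0 : 0 < C by apply: lt_le_trans C1.
have C2inv_gt0 : 0 < (C ^+ 2)^-1 by rewrite invr_gt0 exprn_gt0.
have pM_lt1 : p * M%:R < 1 by lra.
split.
  rewrite /is_frame /row_full mxrank_tr eqn_leq rank_leq_row /=.
  rewrite -[X in (X <= _)%N](@mxrank1 R[i]).
  apply: leq_trans (mxrankM_maxl F (F ^t*)).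
  rewrite tightF -[_%:M in leqRHS]scalemx1 mxrank_scale_nz //.
  by rewrite (fmorph_eq0 (real_complex R)) mulf_neq0 ?invr_neq0 ?lt0r_neq0.
move=> K cardK.
have cardKc : #|~: K|%:R = p * N%:R :> R.
  have : #|K|%:R + #|~: K|%:R = N%:R :> R by rewrite -natrD cardsC card_ord.
  by rewrite cardK; lra.
have gapE : N%:R / M%:R - #|~: K|%:R = N%:R / M%:R * (1 - p * M%:R) :> R.
  by rewrite cardKc; field; rewrite lt0r_neq0.
have a_gt0 : 0 < N%:R / M%:R :> R by rewrite divr_gt0.
apply: le_trans (Cond_col_submx_le tightF unitF _) _.
  by rewrite -subr_gt0 gapE mulr_gt0 // subr_gt0.
rewrite gapE invfM mulrA mulfV ?lt0r_neq0 // mul1r lee_fin.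
rewrite -[leRHS](ger0_norm (ltW C0)) -sqrtr_sqr; apply: ler_wsqrtr.
by rewrite -[leRHS]invrK lef_pV2 ?posrE ?subr_gt0 //; lra.
Qed.

End TightFrames.

(** * The simplex and the permutations of a vector *)

Section SimplexFrame.
Variable R : realType.

(** The Gram matrix [P = Psi* Psi] satisfies [P^2 = ((M+1)/M) P], that is
[Psi* (Psi Psi* - ((M+1)/M) I) Psi = 0]; and [Psi] has full rank [M], because
[P] differs from an invertible matrix of size [M+1] by a matrix of rank one. So
both outer factors cancel. *)
Lemma simplex_cogram (M : nat) (Psi : 'M[R[i]]_(M, M.+1)) : (0 < M)%N ->
  regular_simplex Psi -> Psi *m Psi ^t* = (M.+1%:R / M%:R)%:M.
Proof.
move=> M0 gram; pose P := Psi ^t* *m Psi.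
pose J : 'M[R[i]]_M.+1 := const_mx 1.
have M0C : M%:R != 0 :> R[i] by rewrite pnatr_eq0 -lt0n.
have PP : P *m P = (M.+1%:R / M%:R) *: P.
  have JJ : J *m J = M.+1%:R *: J.
    apply/matrixP=> i j; rewrite !mxE (eq_bigr (fun=> 1)).
      by rewrite sumr_const card_ord mulr1.
    by move=> k _; rewrite !mxE mulr1.
  rewrite /P gram -/J mulmxBl !mul_scalar_mx mulmxBr mul_mx_scalar.
  rewrite -!scalemxAl -!scalemxAr JJ !scalerA.
  apply/matrixP=> i j; rewrite !mxE.
  by field.
have Pr : (M <= \rank P)%N.
  have rank_sum : (M.+1 <= \rank P + \rank (M%:R^-1 *: J))%N.
    apply: leq_trans (mxrank_add _ _).
    rewrite /P gram -/J subrK -scalemx1 mxrank_scale_nz ?mxrank1 //.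
    by rewrite mulf_neq0 ?invr_neq0 // pnatr_eq0.
  have rank_J : (\rank (M%:R^-1 *: J) <= 1)%N.
    have -> : M%:R^-1 *: J =
        (const_mx M%:R^-1 : 'cV_M.+1) *m (const_mx 1 : 'rV_M.+1).
      by apply/matrixP=> i j; rewrite !mxE big_ord1 !mxE.
    by apply: leq_trans (mxrankM_maxl _ _) (rank_leq_col _).
  by move: (leq_trans rank_sum (leq_add (leqnn _) rank_J)); rewrite addn1.
have freePsi : row_free Psi.
  by rewrite /row_free eqn_leq rank_leq_row (leq_trans Pr) ?mxrankM_maxr.
have fullPsi : row_full (Psi ^t*).
  by rewrite /row_full mxrank_map mxrank_tr.
apply: (row_free_inj freePsi); apply: (row_full_inj fullPsi).
by rewrite mul_scalar_mx -scalemxAr -/P -PP /P !mulmxA.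
Qed.

(** The first entry of [g] is [-(M-1)/2] times the last one; this is what makes
the entries sum to zero. *)
Lemma gvec_head_tail (M : nat) : (2 <= M)%N ->
  Num.sqrt ((M%:R - 1) / (2 * (M%:R + 1))) =
  (M%:R - 1) / 2 * Num.sqrt (2 / ((M%:R + 1) * (M%:R - 1))) :> R.
Proof.
move=> M2; have M1 : 1 < M%:R :> R by rewrite ltr1n.
have M1' : 0 <= (M%:R - 1) / 2 :> R by lra.
rewrite -[X in X * Num.sqrt _](ger0_norm M1') -sqrtr_sqr -sqrtrM ?sqr_ge0 //.
congr Num.sqrt; field.
by rewrite !lt0r_neq0 //; lra.
Qed.

Lemma sum_gvec (M : nat) (f : R -> R) : (2 <= M)%N ->
  \sum_i f (gvec R M i 0) =
  f (Num.sqrt ((M%:R - 1) / (2 * (M%:R + 1)))) *+ 2 +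
  f (- Num.sqrt (2 / ((M%:R + 1) * (M%:R - 1)))) *+ M.-1.
Proof.
case: M => [|[|m]] // _.
rewrite 2!big_ord_recl !mxE /= addrA -mulr2n; congr (_ + _).
rewrite (eq_bigr (fun=> f (gvec R m.+2 ord_max 0))); last first.
  by move=> i _; rewrite !mxE.
by rewrite sumr_const card_ord !mxE.
Qed.

Lemma gvec_sum0 (M : nat) : (2 <= M)%N -> \sum_i gvec R M i 0 = 0.
Proof.
move=> M2; rewrite (sum_gvec id M2) gvec_head_tail //.
case: M M2 => // M _; rewrite -natr1 addrK /= -mulr_natr -[_ *+ M]mulr_natr.
by field.
Qed.

Lemma gvec_sqnorm (M : nat) : (2 <= M)%N -> \sum_i gvec R M i 0 ^+ 2 = 1.
Proof.
move=> M2; rewrite (sum_gvec (fun x => x ^+ 2) M2) sqrrN.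
have M1 : 1 < M%:R :> R by rewrite ltr1n.
rewrite !sqr_sqrtr; try (by rewrite divr_ge0 ?mulr_ge0 //; lra).
case: M M2 M1 => // M _ M1; rewrite -natr1 in M1 *.
rewrite addrK -[_ *+ M.+1.-1]mulr_natr -[_ *+ 2]mulr_natr /=; field.
by rewrite !lt0r_neq0 //; lra.
Qed.

Section Orbit.
Variables (M N : nat) (g : 'cV[R]_M.+1) (v_ : 'I_N -> 'cV[R]_M.+1).
Hypotheses (M_gt0 : (0 < M)%N) (g_sum : \sum_i g i 0 = 0)
  (g_sqnorm : \sum_i g i 0 ^+ 2 = 1).
Hypotheses (v_inj : injective v_)
  (v_range : range v_ = [set perm_mx s *m g | s in [set: 'S_M.+1]]%classic).

Lemma orbit_perm j : exists s : 'S_M.+1, forall i, v_ j i 0 = g (s i) 0.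
Proof.
have : range v_ (v_ j) by exists j.
by rewrite v_range => -[s _ <-]; exists s => i; rewrite -row_permE mxE.
Qed.

Lemma orbit_sum0 j : \sum_i v_ j i 0 = 0.
Proof.
have [s vE] := orbit_perm j.
rewrite -[RHS]g_sum [RHS](reindex_inj (@perm_inj _ s)).
by apply: eq_bigr => i _; rewrite vE.
Qed.

Lemma orbit_sqnorm j : \sum_i v_ j i 0 ^+ 2 = 1.
Proof.
have [s vE] := orbit_perm j.
rewrite -[RHS]g_sqnorm [RHS](reindex_inj (@perm_inj _ s)).
by apply: eq_bigr => i _; rewrite vE.
Qed.

(** Since [v_] enumerates an orbit without repetition, permuting the coordinates
of all the [v_ j] amounts to permuting the index [j]. *)
Lemma orbit_reindex (s : 'S_M.+1) :
  exists2 h : 'I_N -> 'I_N,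
    injective h & forall j i, v_ (h j) i 0 = v_ j (s i) 0.
Proof.
have /choice[h hE] : forall j, exists j', v_ j' = perm_mx s *m v_ j.
  move=> j; have : range v_ (v_ j) by exists j.
  rewrite v_range => -[t _ <-].
  have : [set perm_mx s *m g | s in [set: 'S_M.+1]]%classic
      (perm_mx (s * t)%g *m g).
    by exists (s * t)%g.
  by rewrite -v_range => -[j' _ vj']; exists j'; rewrite vj' mulmxA -perm_mxM.
exists h => [j j' hj|j i]; last by rewrite hE -row_permE mxE.
apply: v_inj; apply/colP => i; have := hE j'.
rewrite -hj hE => /colP/(_ (s^-1 i)%g).
by rewrite -!row_permE !mxE permKV.
Qed.

Definition orbit_gram i k := \sum_j v_ j i 0 * v_ j k 0.

Lemma orbit_gram_perm (s : 'S_M.+1) i k :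
  orbit_gram (s i) (s k) = orbit_gram i k.
Proof.
have [h h_inj hE] := orbit_reindex s.
by rewrite [RHS](reindex_inj h_inj); apply: eq_bigr => j _; rewrite !hE.
Qed.

(** A transposition exchanges any two diagonal entries, so they are all equal to
the average of the trace, and the trace is the sum of the [|v_ j|^2]. *)
Lemma orbit_gram_diag i : orbit_gram i i = N%:R / M.+1%:R.
Proof.
have trG : \sum_k orbit_gram k k = N%:R.
  rewrite exchange_big /= (eq_bigr (fun=> 1)) ?sumr_const ?card_ord // => j _.
  by rewrite -(orbit_sqnorm j); apply: eq_bigr => k _; rewrite expr2.
rewrite -trG (eq_bigr (fun=> orbit_gram i i)).
  rewrite sumr_const card_ord -[orbit_gram i i *+ _]mulr_natr.
  by rewrite mulfK // pnatr_eq0.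
by move=> k _; rewrite -(orbit_gram_perm (tperm i k)) tpermR.
Qed.

(** A transposition fixing [i] exchanges any two off-diagonal entries of row
[i], so these are equal; the diagonal entry and the zero row sum then give their
value. The result is [N/(M+1)] times the Gram matrix of a regular simplex. *)
Lemma orbit_gramE i k :
  orbit_gram i k = N%:R / M.+1%:R * (M.+1%:R / M%:R *+ (i == k) - M%:R^-1).
Proof.
have MR : M%:R != 0 :> R by rewrite pnatr_eq0 -lt0n.
have M1R : M.+1%:R != 0 :> R by rewrite pnatr_eq0.
have [->|ik] := eqVneq i k.
  by rewrite orbit_gram_diag mulr1n -natr1 in M1R *; field; rewrite MR.
have rowG : \sum_l orbit_gram i l = 0.
  rewrite exchange_big /= big1 // => j _.
  by rewrite -mulr_sumr orbit_sum0 mulr0.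
have offG l : l != i -> orbit_gram i l = orbit_gram i k.
  move=> li; rewrite -(orbit_gram_perm (tperm l k)) tpermL tpermD //.
  by rewrite eq_sym.
move: rowG; rewrite (bigD1 i) //= (eq_bigr (fun=> orbit_gram i k) offG).
rewrite sumr_const cardC1 card_ord /= orbit_gram_diag.
rewrite -[orbit_gram i k *+ _]mulr_natr; move/(canRL (addKr _)) => G.
apply: (mulIf MR); rewrite G mulr0n -natr1 in M1R *; field.
by rewrite MR M1R.
Qed.

End Orbit.

(** * The frame of permuted columns *)

Section PermutationFrame.
Variables (M N : nat) (Psi : 'M[R[i]]_(M, M.+1)) (F : 'M[R[i]]_(M, N)).
Variable g : 'cV[R]_M.+1.
Hypotheses (M_gt0 : (0 < M)%N) (g_sum : \sum_i g i 0 = 0)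
  (g_sqnorm : \sum_i g i 0 ^+ 2 = 1).
Hypotheses (simplexPsi : regular_simplex Psi)
  (FE : permutation_columns Psi g F).

(** Storing the permutations of [g] as the columns of [V] turns the column-wise
description of [F] into a matrix identity. *)
Lemma permutation_frame_factor : exists V : 'M[R]_(M.+1, N),
  [/\ F = (Num.sqrt (M%:R / (M%:R + 1) : R))%:C%C *:
            (Psi *m map_mx (real_complex R) V),
      V *m V^T = (N%:R / M.+1%:R) *:
            ((M.+1%:R / M%:R)%:M - M%:R^-1 *: const_mx 1),
      (forall j, \sum_i V i j = 0) & forall j, \sum_i V i j ^+ 2 = 1].
Proof.
have [v_ [v_inj v_range colF]] := FE.
exists (\matrix_(i, j) v_ j i 0); split.
- apply/matrixP => i j; have /colP/(_ i) := colF j; rewrite !mxE => ->.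
  by congr (_ * _); apply: eq_bigr => k _; rewrite !mxE.
- apply/matrixP => i k; rewrite !mxE mulr1.
  rewrite -(orbit_gramE M_gt0 g_sum g_sqnorm v_inj v_range).
  by apply: eq_bigr => j _; rewrite !mxE.
- move=> j; rewrite -[RHS](orbit_sum0 g_sum v_range j).
  by apply: eq_bigr => i _; rewrite mxE.
- move=> j; rewrite -[RHS](orbit_sqnorm g_sqnorm v_range j).
  by apply: eq_bigr => i _; rewrite mxE.
Qed.

Lemma permutation_frame_scale_sq :
  let c := (Num.sqrt (M%:R / (M%:R + 1) : R))%:C%C in c * c = M%:R / M.+1%:R.
Proof.
rewrite /= -rmorphM -expr2 sqr_sqrtr ?divr_ge0 ?addr_ge0 //= natr1.
exact: real_complex_ratio.
Qed.

Lemma permutation_frame_tight : F *m F ^t* = ((N%:R / M%:R)%:C)%C%:M.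
Proof.
have [V [-> VV _ _]] := permutation_frame_factor.
have MC : M%:R != 0 :> R[i] by rewrite pnatr_eq0 -lt0n.
have M1C : M.+1%:R != 0 :> R[i] by rewrite pnatr_eq0.
rewrite conj_scale_real trmx_mul map_mxM conj_map_real -scalemxAl -scalemxAr.
rewrite scalerA permutation_frame_scale_sq !mulmxA.
rewrite -[_ *m _ *m map_mx _ V^T]mulmxA -map_mxM VV.
have -> : map_mx (real_complex R)
    ((N%:R / M.+1%:R) *: ((M.+1%:R / M%:R)%:M - M%:R^-1 *: const_mx 1)) =
    (N%:R / M.+1%:R) *: (Psi ^t* *m Psi).
  rewrite simplexPsi map_mxZ map_mxB map_mxZ map_scalar_mx map_const_mx.
  by rewrite /= !fmorph_div fmorphV !rmorph_nat rmorph1.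
rewrite -scalemxAr -scalemxAl scalerA !mulmxA simplex_cogram //.
rewrite -mulmxA simplex_cogram // -scalar_mxM scale_scalar_mx.
congr _%:M; rewrite real_complex_ratio -natr1 in M1C *; field.
by rewrite MC M1C.
Qed.

(** The term [J / M] of [Psi* Psi] kills the columns of [V], whose sums
vanish. *)
Lemma permutation_frame_unit j : (F ^t* *m F) j j = 1.
Proof.
have [V [-> _ V_sum V_sq]] := permutation_frame_factor.
have MC : M%:R != 0 :> R[i] by rewrite pnatr_eq0 -lt0n.
have M1C : M.+1%:R != 0 :> R[i] by rewrite pnatr_eq0.
rewrite conj_scale_real trmx_mul map_mxM conj_map_real -scalemxAl -scalemxAr.
rewrite scalerA permutation_frame_scale_sq mulmxA.
rewrite -[_ *m _ *m Psi]mulmxA simplexPsi.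
have JV : const_mx 1 *m map_mx (real_complex R) V = 0 :> 'M_(M.+1, N).
  apply/matrixP => i k; rewrite !mxE.
  rewrite -[RHS](rmorph0 (real_complex R)) -(V_sum k) rmorph_sum.
  by apply: eq_bigr => l _; rewrite !mxE mul1r.
rewrite -mulmxA mulmxBl -scalemxAl JV scaler0 subr0 mul_scalar_mx -scalemxAr.
rewrite scalerA -map_mxM !mxE.
have -> : \sum_i V^T j i * V i j = 1.
  by rewrite -(V_sq j); apply: eq_bigr => i _; rewrite mxE expr2.
by rewrite rmorph1 mulr1 -natr1 in M1C *; field; rewrite MC M1C.
Qed.

End PermutationFrame.
End SimplexFrame.

Theorem theorem9 (R : realType) (M : nat) (hM : (7 <= M)%N)
    (Psi : 'M[R[i]]_(M, M.+1)) (hPsi : regular_simplex Psi)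
    (F : 'M[R[i]]_(M, 'C(M.+1, 2)))
    (hF : permutation_columns Psi (gvec R M) F)
    (C : R) (hC : 1 <= C)
    (p : R) (hp0 : 0 <= p) (hp1 : p <= 1)
    (hpN : (1 - p) * ('C(M.+1, 2))%:R \is a Num.int)
    (hp : p <= (C ^+ 2 - 1) ^+ 2 / ((C ^+ 2 + 1) ^+ 2 * (M%:R + 1))) :
  nerf p C F.
Proof.
have M2 : (2 <= M)%N by apply: leq_trans hM.
have M0 : (0 < M)%N by apply: leq_trans hM.
have g0 := gvec_sum0 R M2; have g1 := gvec_sqnorm R M2.
apply: unit_tight_frame_nerf => //.
- by rewrite bin_gt0 ltnS.
- exact: permutation_frame_tight hF.
- exact: permutation_frame_unit hF.
have MR : 0 <= M%:R :> R by [].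
have C2 : 1 <= C ^+ 2 by rewrite exprn_ege1.
(* [p <= d^2 / (M+1)] with [d = (C^2 - 1) / (C^2 + 1)] in [0, 1] implies
   [p M <= d^2 <= 2 d / (1 + d) = 1 - 1 / C^2]. *)
move: (C ^+ 2) C2 hp => c c1; rewrite invfM mulrA -expr_div_n.
set d := (c - 1) / (c + 1).
have d0 : 0 <= d by rewrite divr_ge0; lra.
have d1 : d <= 1 by rewrite ler_pdivrMr; lra.
have -> : 1 - c^-1 = 2 * d / (1 + d).
  rewrite /d; field; rewrite !lt0r_neq0 //; lra.
rewrite ler_pdivlMr; last by lra.
rewrite ler_pdivlMr; last by lra.
nra.
Qed.
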